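(* Let $n\ge 2$, let $S_n$ be the set of all $n\times n$ real symmetric matrices, and let $(0,\infty)=\{C\in S_n : C> 0\}$. Let $\phi : (0, \infty ) \to (0, \infty)$ be an order automorphism. Then there exists a real invertible $n \times n$ matrix $T$ such that $\phi (X) = TXT^t$ for every $X \in (0, \infty)$.
   Context: For $A,B\in S_n$, $A\le B$ means that $B-A$ is positive semidefinite, and $C>0$ means that $C$ is positive definite (positive semidefinite and invertible). $T^t$ is the transpose of $T$. An order automorphism of a subset $M\subset S_n$ is a bijective map $\phi:M\to M$ such that for all $X,Y\in M$: $X\le Y\iff\phi(X)\le\phi(Y)$. *)

(* Defs.v *)
From mathcomp Require Import all_boot all_order all_algebra.
From mathcomp Require Import boolp classical_sets functions reals.

Set Implicit Arguments.
Unset Strict Implicit.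
Unset Printing Implicit Defensive.

Import Order.TTheory GRing.Theory Num.Theory.

Local Open Scope classical_set_scope.
Local Open Scope ring_scope.

Definition sym_mx (R : realType) (n : nat) : set 'M[R]_n :=
  [set A | A \is symmetricmx].

Definition posemidef (R : realType) (n : nat) : set 'M[R]_n :=
  [set A | sym_mx A /\ forall x : 'cV[R]_n, 0 <= (x^T *m A *m x) 0 0].

Definition posdef (R : realType) (n : nat) : set 'M[R]_n :=
  [set C | posemidef C /\ C \in unitmx].

Definition loewner_le (R : realType) (n : nat) (A B : 'M[R]_n) : Prop :=
  posemidef (B - A).

(* Maps are total on 'M[R]_n, but only their values on M matter. *)
Definition order_automorphism (R : realType) (n : nat) (M : set 'M[R]_n)
    (phi : 'M[R]_n -> 'M[R]_n) : Prop :=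
  [/\ M `<=` @sym_mx R n, set_bij M M phi &
      forall X Y : 'M[R]_n, M X -> M Y ->
        (loewner_le X Y <-> loewner_le (phi X) (phi Y))].

(* Main.v *)
Require Import Defs.
From mathcomp Require Import all_boot all_order all_algebra.
From mathcomp Require Import boolp classical_sets functions reals.
From mathcomp Require Import ring lra.

Set Implicit Arguments.
Unset Strict Implicit.
Unset Printing Implicit Defensive.

Import Order.TTheory GRing.Theory Num.Theory.

Local Open Scope classical_set_scope.
Local Open Scope ring_scope.

(** Since [D >= 0] has rank at most one iff the order interval [[0, D]] is a
    chain, [phi] maps rays [X + t v v^T] onto rays [phi X + s w w^T].  Two such
    rays are parallel when every point of one is dominated by a point of the
    other, so the direction [w] depends on [v] only.  Completing parallelograms
    spanned by two independent directions shows that the increment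
    [phi (X + P) - phi X] does not depend on [X]; it is thus additive in
    [P >= 0], and monotonicity makes it homogeneous.  Hence [phi] is the
    restriction of an additive cone map [L] plus a constant, which vanishes
    because [phi] is onto the open cone.  As [L] preserves rank one, it can be
    normalised by a congruence so as to fix every [e_i e_i^T]; then
    [L (v v^T)] has entries [w_i w_j v_i v_j] for fixed signs [w_i]. *)

(** * Positive semidefinite matrices *)

Section PsdMatrices.
Variables (R : realType) (n : nat).
Implicit Types (A B C D T X Y P Q : 'M[R]_n) (x y u v w : 'cV[R]_n).

Definition dot u v : R := (u^T *m v) 0 0.

Definition outer v : 'M[R]_n := v *m v^T.

Lemma dotE u v : dot u v = \sum_i u i 0 * v i 0.
Proof. by rewrite /dot mxE; apply: eq_bigr => i _; rewrite mxE. Qed.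

Lemma dotC u v : dot u v = dot v u.
Proof. by rewrite !dotE; apply: eq_bigr => i _; rewrite mulrC. Qed.

Lemma dotDr u v w : dot u (v + w) = dot u v + dot u w.
Proof. by rewrite /dot mulmxDr mxE. Qed.

Lemma dotZr a u v : dot u (a *: v) = a * dot u v.
Proof. by rewrite /dot -scalemxAr mxE. Qed.

Lemma dotNr u v : dot u (- v) = - dot u v.
Proof. by rewrite -scaleN1r dotZr mulN1r. Qed.

Lemma dot0r u : dot u 0 = 0.
Proof. by rewrite -(scale0r 0) dotZr mul0r. Qed.

Lemma dotDl u v w : dot (u + v) w = dot u w + dot v w.
Proof. by rewrite !(dotC _ w) dotDr. Qed.

Lemma dotZl a u v : dot (a *: u) v = a * dot u v.
Proof. by rewrite !(dotC _ v) dotZr. Qed.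

Lemma dotNl u v : dot (- u) v = - dot u v.
Proof. by rewrite !(dotC _ v) dotNr. Qed.

Definition dotlin := (dotDl, dotDr, dotNl, dotNr, dotZl, dotZr).

Lemma dot_ge0 v : 0 <= dot v v.
Proof. by rewrite dotE; apply: sumr_ge0 => i _; rewrite -expr2 sqr_ge0. Qed.

Lemma dot_eq0 v : dot v v = 0 -> v = 0.
Proof.
rewrite dotE => /eqP; rewrite psumr_eq0 => [/allP v0|i _]; last first.
  by rewrite -expr2 sqr_ge0.
apply/matrixP => i j; rewrite ord1 mxE; apply/eqP.
by have := v0 i (mem_index_enum _); rewrite mulf_eq0 orbb.
Qed.

Lemma dot_gt0 v : v != 0 -> 0 < dot v v.
Proof.
move=> v0; rewrite lt_neqAle dot_ge0 andbT eq_sym.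
by apply: contra v0 => /eqP/dot_eq0 ->.
Qed.

Lemma dot_delta i v : dot (delta_mx i 0) v = v i 0.
Proof.
rewrite dotE (bigD1 i) //= big1 => [|j ji].
  by rewrite mxE !eqxx mul1r addr0.
by rewrite mxE (negbTE ji) mul0r.
Qed.

Lemma dot_mulmx A x y : dot x (A *m y) = dot (A^T *m x) y.
Proof. by rewrite /dot trmx_mul trmxK mulmxA. Qed.

Lemma dot_entry A i j : dot (delta_mx i 0) (A *m delta_mx j 0) = A i j.
Proof. by rewrite dot_delta -colE mxE. Qed.

Lemma outer_mul v x : outer v *m x = dot v x *: v.
Proof.
rewrite /outer -mulmxA; apply/matrixP => i j; rewrite !mxE big_ord1 !ord1.
by rewrite mulrC.
Qed.

Lemma outerE v i j : outer v i j = v i 0 * v j 0.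
Proof. by rewrite /outer mxE big_ord1 mxE. Qed.

Lemma tr_outer v : (outer v)^T = outer v.
Proof. by rewrite /outer trmx_mul trmxK. Qed.

Lemma outerZ a v : outer (a *: v) = a ^+ 2 *: outer v.
Proof. by apply/matrixP => i j; rewrite [RHS]mxE !outerE !mxE; ring. Qed.

Lemma outer0 : outer 0 = 0.
Proof. by rewrite /outer mul0mx. Qed.

Lemma outer_eq0 v : outer v = 0 -> v = 0.
Proof.
move=> o0; apply: dot_eq0; have := outer_mul v v.
rewrite o0 mul0mx => /(congr1 (dot v)); rewrite dot0r dotZr => /esym/eqP.
by rewrite mulf_eq0 orbb => /eqP.
Qed.

Lemma outer_sqrt a v : 0 <= a -> a *: outer v = outer (Num.sqrt a *: v).
Proof. by move=> a0; rewrite outerZ sqr_sqrtr. Qed.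

Lemma mulmx_outer A v : A *m outer v *m A^T = outer (A *m v).
Proof. by rewrite /outer trmx_mul !mulmxA. Qed.

Lemma symP A : A \is symmetricmx <-> A^T = A.
Proof.
by split=> [/is_hermitianmxP|AT]; [|apply/is_hermitianmxP];
  rewrite expr0 scale1r map_mx_id //= => <-; rewrite ?trmxK.
Qed.

Lemma psdP A :
  posemidef A <-> A^T = A /\ forall x, 0 <= dot x (A *m x).
Proof.
split=> -[/symP sA A0]; split=> // x.
  by rewrite /dot mulmxA.
by have := A0 x; rewrite /dot mulmxA.
Qed.

Lemma psd_sym A : posemidef A -> A^T = A.
Proof. by move=> /psdP[]. Qed.

Lemma psd_ge0 A x : posemidef A -> 0 <= dot x (A *m x).
Proof. by move=> /psdP[]. Qed.

Lemma psd_outer v : posemidef (outer v).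
Proof.
apply/psdP; split=> [|x]; first exact: tr_outer.
by rewrite outer_mul dotZr dotC -expr2 sqr_ge0.
Qed.

Lemma psdD A B : posemidef A -> posemidef B -> posemidef (A + B).
Proof.
move=> /psdP[sA A0] /psdP[sB B0]; apply/psdP; split=> [|x].
  by rewrite linearD /= sA sB.
by rewrite mulmxDl dotDr addr_ge0.
Qed.

Lemma psdZ a A : 0 <= a -> posemidef A -> posemidef (a *: A).
Proof.
move=> a0 /psdP[sA A0]; apply/psdP; split=> [|x].
  by rewrite linearZ /= sA.
by rewrite -scalemxAl dotZr mulr_ge0.
Qed.

Lemma psd0 : posemidef (0 : 'M[R]_n).
Proof. by rewrite -outer0; apply: psd_outer. Qed.

Lemma psd_sum (I : Type) (s : seq I) (F : I -> 'M[R]_n) :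
  (forall i, posemidef (F i)) -> posemidef (\sum_(i <- s) F i).
Proof. by move=> F0; elim/big_ind: _ => //; [exact: psd0 | exact: psdD]. Qed.

Lemma psd1 : posemidef (1%:M : 'M[R]_n).
Proof.
apply/psdP; split=> [|x]; first by rewrite trmx1.
by rewrite mul1mx dot_ge0.
Qed.

Lemma psd_congr A T : posemidef A -> posemidef (T *m A *m T^T).
Proof.
move=> /psdP[sA A0]; apply/psdP; split=> [|x].
  by rewrite !trmx_mul trmxK sA mulmxA.
by rewrite -!mulmxA dot_mulmx.
Qed.

Lemma le_form A B x :
  posemidef (B - A) -> dot x (A *m x) <= dot x (B *m x).
Proof. by move=> /(psd_ge0 x); rewrite mulmxBl dotDr dotNr subr_ge0. Qed.

Lemma psd_dotC A x y : posemidef A -> dot x (A *m y) = dot y (A *m x).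
Proof. by move=> /psd_sym sA; rewrite dot_mulmx sA dotC. Qed.

Lemma psd_form A x y a : posemidef A ->
  dot (x + a *: y) (A *m (x + a *: y)) =
  dot x (A *m x) + a * 2 * dot x (A *m y) + a ^+ 2 * dot y (A *m y).
Proof.
move=> A0; rewrite mulmxDr -scalemxAr !dotlin (psd_dotC y x A0).
by ring.
Qed.

(** Cauchy-Schwarz for the form of [A]: the quadratic polynomial [F] in [a] is nonnegative
    everywhere, so its discriminant is not positive. *)
Lemma psd_CS A x y : posemidef A ->
  dot x (A *m y) ^+ 2 <= dot x (A *m x) * dot y (A *m y).
Proof.
move=> A0; set p := dot x (A *m x); set q := dot y (A *m y).
set b := dot x (A *m y).
have F a : 0 <= p + a * 2 * b + a ^+ 2 * q.
  by rewrite -psd_form //; apply: psd_ge0.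
have q0 : 0 <= q by apply: psd_ge0.
have [q_eq0|q_neq0] := eqVneq q 0.
  have [->|b_neq0] := eqVneq b 0; first by rewrite q_eq0 mulr0 expr0n.
  (* With [q = 0] the polynomial is affine in [a]; this value of [a] gives it the value [-1]. *)
  have := F (- (p + 1) / (2 * b)); rewrite q_eq0 mulr0 addr0.
  have -> : - (p + 1) / (2 * b) * 2 * b = - (p + 1) by field.
  by lra.
have q_gt0 : 0 < q by rewrite lt_neqAle eq_sym q_neq0.
(* The minimiser of the polynomial. *)
have := F (- b / q).
have -> : p + - b / q * 2 * b + (- b / q) ^+ 2 * q = (p * q - b ^+ 2) / q.
  by field.
by rewrite pmulr_lge0 ?invr_gt0 // subr_ge0.
Qed.

Lemma psd_ker A x : posemidef A -> dot x (A *m x) = 0 -> A *m x = 0.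
Proof.
move=> A0 Ax; apply: dot_eq0; have := psd_CS (A *m x) x A0.
by rewrite Ax mulr0 => h; apply/eqP; rewrite -sqrf_eq0 eq_le h sqr_ge0.
Qed.

(** The form of [A - B] is identically zero, so [A - B] is semidefinite and every vector lies in its
    kernel by [psd_ker]. *)
Lemma form_inj A B : A^T = A -> B^T = B ->
  (forall x, dot x (A *m x) = dot x (B *m x)) -> A = B.
Proof.
move=> sA sB AB.
have D0 x : dot x ((A - B) *m x) = 0.
  by rewrite mulmxBl dotDr dotNr AB subrr.
have AB_psd : posemidef (A - B).
  by apply/psdP; split=> [|x]; rewrite ?linearB /= ?sA ?sB // D0.
apply/eqP; rewrite -subr_eq0; apply/eqP/matrixP => i j.
by rewrite -dot_entry (psd_ker AB_psd (D0 _)) dot0r mxE.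
Qed.

Lemma psd_anti A : posemidef A -> posemidef (- A) -> A = 0.
Proof.
move=> A0 NA0; apply: form_inj; rewrite ?trmx0 ?psd_sym // => x.
apply/eqP; rewrite mul0mx dot0r eq_le psd_ge0 // andbT.
by have := psd_ge0 x NA0; rewrite mulNmx dotNr oppr_ge0.
Qed.

(** The form of [A] is squeezed to zero on the orthogonal complement of [v], so [A] kills that
    complement and is determined by its value at [v]. *)
Lemma psd_below_outer A v : posemidef A -> posemidef (outer v - A) ->
  exists2 c, 0 <= c & A = c *: outer v.
Proof.
move=> A0 vA0; have [v_eq0|v_neq0] := eqVneq v 0.
  exists 0 => //; rewrite scale0r; apply: psd_anti => //.
  by rewrite v_eq0 outer0 sub0r in vA0.
have vv := dot_gt0 v_neq0.
have Aperp x : dot v x = 0 -> A *m x = 0.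
  move=> vx; apply: psd_ker => //; apply/eqP; rewrite eq_le psd_ge0 // andbT.
  by apply: le_trans (le_form x vA0) _; rewrite outer_mul vx scale0r dot0r.
pose c := dot v (A *m v) / dot v v ^+ 2.
exists c; first by rewrite divr_ge0 ?psd_ge0 ?sqr_ge0.
apply: form_inj; rewrite ?linearZ /= ?tr_outer ?psd_sym // => x.
pose a := dot v x / dot v v.
have [y vy ->] : exists2 y, dot v y = 0 & x = y + a *: v.
  exists (x - a *: v); last by rewrite subrK.
  by rewrite /a !dotlin; field; rewrite gt_eqF.
rewrite psd_form // -scalemxAl outer_mul !dotlin vy.
rewrite (psd_dotC _ _ A0) (Aperp _ vy) !dot0r /c (dotC y) vy.
by field; rewrite gt_eqF.
Qed.

Lemma psd_schur A x : posemidef A -> 0 < dot x (A *m x) ->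
  posemidef (A - (dot x (A *m x))^-1 *: outer (A *m x)).
Proof.
move=> A0 Ax; apply/psdP; split=> [|y].
  by rewrite linearB linearZ /= tr_outer psd_sym.
rewrite mulmxBl -scalemxAl outer_mul !dotlin subr_ge0 (dotC _ y) -expr2.
by rewrite ler_pdivrMl // (psd_dotC y x A0) psd_CS.
Qed.

Lemma schur_ker A x : posemidef A -> 0 < dot x (A *m x) ->
  (A - (dot x (A *m x))^-1 *: outer (A *m x)) *m x = 0.
Proof.
move=> A0 Ax; rewrite mulmxBl -scalemxAl outer_mul scalerA (dotC _ x).
by rewrite mulVf ?gt_eqF // scale1r subrr.
Qed.

(** Symmetric Gaussian elimination: each Schur complement clears one more column and keeps the
    cleared ones zero. A zero pivot needs no subtraction, since [psd_ker] makes its column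
    vanish. *)
Lemma psd_peel A k : posemidef A -> (k <= n)%N ->
  exists s : seq 'cV[R]_n, posemidef (A - \sum_(v <- s) outer v) /\
    forall i : 'I_n, (i < k)%N ->
      (A - \sum_(v <- s) outer v) *m delta_mx i 0 = 0 :> 'cV[R]_n.
Proof.
move=> A0; elim: k => [|k IHk] kn; first by exists [::]; rewrite big_nil subr0.
have [s [Ps Ks]] := IHk (ltnW kn).
pose D := A - \sum_(v <- s) outer v.
pose e : 'cV[R]_n := delta_mx (Ordinal kn) 0.
have ltkE (i : 'I_n) : (i < k.+1)%N -> (i < k)%N \/ i = Ordinal kn.
  by rewrite ltnS leq_eqVlt => /orP[/eqP ik|]; [right; apply: val_inj | left].
have [De|De] := eqVneq (dot e (D *m e)) 0.
  exists s; split=> // i /ltkE[/Ks //| ->].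
  exact: psd_ker.
have De_gt0 : 0 < dot e (D *m e) by rewrite lt_neqAle eq_sym De psd_ge0.
pose a := (dot e (D *m e))^-1.
exists (Num.sqrt a *: (D *m e) :: s).
have -> : A - \sum_(v <- Num.sqrt a *: (D *m e) :: s) outer v =
          D - a *: outer (D *m e).
  rewrite big_cons -outer_sqrt ?invr_ge0 ?(ltW De_gt0) //.
  by rewrite opprD addrCA addrC.
split=> [|i /ltkE[/Ks Di| ->]]; [exact: psd_schur | | exact: schur_ker].
have {}Di : D *m delta_mx i 0 = 0 :> 'cV[R]_n by [].
rewrite mulmxBl -scalemxAl outer_mul Di (dotC (D *m e)) (psd_dotC _ _ Ps) Di.
by rewrite dot0r scale0r scaler0 subr0.
Qed.

Lemma psd_sum_outer A : posemidef A ->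
  exists s : seq 'cV[R]_n, A = \sum_(v <- s) outer v.
Proof.
move=> A0; have [s [_ Ks]] := psd_peel A0 (leqnn n).
exists s; apply/eqP; rewrite -subr_eq0; apply/eqP/matrixP => i j.
by rewrite -dot_entry Ks // dot0r mxE.
Qed.

(** This describes rank at most one by the order alone, which is what an order automorphism can
    transport. *)
Lemma outer_chainP D : posemidef D ->
  (forall A B, posemidef A -> posemidef (D - A) ->
     posemidef B -> posemidef (D - B) ->
     posemidef (B - A) \/ posemidef (A - B)) <->
  exists v, D = outer v.
Proof.
move=> D0; split=> [chain|[v ->] A B A0 vA B0 vB]; last first.
  have [a a0 ->] := psd_below_outer A0 vA.
  have [b b0 ->] := psd_below_outer B0 vB.
  rewrite -!scalerBl; case: (leP a b) => ab; [left|right];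
    by apply: psdZ (psd_outer _); rewrite subr_ge0 // ltW.
have [[x Dx]|D_eq0] := pselect (exists x, dot x (D *m x) != 0); last first.
  exists 0; rewrite outer0; apply: form_inj; rewrite ?trmx0 ?psd_sym // => x.
  rewrite mul0mx dot0r; apply/eqP; apply: contrapT => /negP Dx.
  by apply: D_eq0; exists x.
have {}Dx : 0 < dot x (D *m x) by rewrite lt_neqAle eq_sym Dx psd_ge0.
pose a := (dot x (D *m x))^-1.
have a0 : 0 <= a by rewrite invr_ge0 ltW.
pose E := a *: outer (D *m x).
have E0 : posemidef E by apply: psdZ (psd_outer _).
have DE0 : posemidef (D - E) by apply: psd_schur.
have DEx : (D - E) *m x = 0 by apply: schur_ker.
have Ex : E *m x = D *m x.
  by apply/eqP; rewrite eq_sym -subr_eq0 -mulmxBl DEx.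
have DDE : posemidef (D - (D - E)) by rewrite subKr.
(* [E] is positive at [x] while [D - E] vanishes there, so the chain condition leaves only
   [D - E <= E], and [E] has rank one. *)
have [h|] := chain E (D - E) E0 DE0 DE0 DDE.
  have := le_form x h; rewrite DEx Ex dot0r leNgt.
  by rewrite Dx.
rewrite {1}/E outer_sqrt // => h.
have [c c0 DEc] := psd_below_outer DE0 h.
exists (Num.sqrt (c + 1) *: (Num.sqrt a *: (D *m x))).
rewrite -outer_sqrt ?addr_ge0 // scalerDl scale1r -DEc -outer_sqrt //.
by rewrite subrK.
Qed.

(** * Positive definite matrices *)

Lemma posdefP C :
  posdef C <-> C^T = C /\ forall x, x != 0 -> 0 < dot x (C *m x).
Proof.
split=> [[C0 uC]|[sC C0]].
  split=> [|x x0]; first exact: psd_sym.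
  rewrite lt_neqAle psd_ge0 // andbT eq_sym.
  apply: contra x0 => /eqP/(psd_ker C0) Cx.
  by rewrite -(mulKmx uC x) Cx mulmx0.
split; first apply/psdP; first split=> // x.
  have [->|/C0/ltW//] := eqVneq x 0.
  by rewrite mulmx0 dot0r.
rewrite -unitmx_tr -row_free_unit; apply/row_freeP.
have : kermx C^T = 0.
  apply/row_matrixP => i; rewrite row0; set u := row i _.
  have uC : u *m C^T = 0 by rewrite /u -row_mul mulmx_ker row0.
  apply: trmx_inj; rewrite trmx0; apply/eqP; apply: contraT => /C0.
  by rewrite -(trmxK (C *m _)) trmx_mul trmxK uC trmx0 dot0r ltxx.
by move=> k0; apply/row_freeP; rewrite -kermx_eq0 k0.
Qed.

Lemma posdef_psd C : posdef C -> posemidef C.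
Proof. by case. Qed.

Lemma posdefD C A : posdef C -> posemidef A -> posdef (C + A).
Proof.
move=> /posdefP[sC C0] A0; apply/posdefP; split=> [|x /C0 x0].
  by rewrite linearD /= sC psd_sym.
by rewrite mulmxDl dotDr ltr_wpDr // psd_ge0.
Qed.

Lemma posdefZ a C : 0 < a -> posdef C -> posdef (a *: C).
Proof.
move=> a0 /posdefP[sC C0]; apply/posdefP; split=> [|x /C0 x0].
  by rewrite linearZ /= sC.
by rewrite -scalemxAl dotZr mulr_gt0.
Qed.

Lemma posdef1 : posdef (1%:M : 'M[R]_n).
Proof. by split; [exact: psd1 | exact: unitmx1]. Qed.

Lemma outer_parallel a u v : outer u = a *: outer v -> exists b, u = b *: v.
Proof.
move=> uv; have [->|u0] := eqVneq u 0; first by exists 0; rewrite scale0r.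
exists ((dot u u)^-1 * (a * dot v u)).
have := congr1 (mulmx^~ u) uv; rewrite -scalemxAl !outer_mul => uE.
by rewrite -!scalerA -uE scalerA mulVf ?scale1r // gt_eqF ?dot_gt0.
Qed.

End PsdMatrices.

(** * Additive functions and limits on the real line *)

(** Cauchy's functional equation on the half-line: nonnegativity makes [f] monotone, and bracketing
    [m * t] between consecutive integers bounds [m] times the defect by [f 1] for every [m]. *)
Lemma additive_nonneg_linear (R : realType) (f : R -> R) :
  (forall s t, 0 <= s -> 0 <= t -> f (s + t) = f s + f t) ->
  (forall t, 0 <= t -> 0 <= f t) ->
  forall t, 0 <= t -> f t = t * f 1.
Proof.
move=> fD f0.
have f00 : f 0 = 0.
  by have := fD 0 0 (lexx _) (lexx _); rewrite addr0; lra.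
have fM (k : nat) t : 0 <= t -> f (k%:R * t) = k%:R * f t.
  move=> t0; elim: k => [|k IHk]; first by rewrite !mul0r f00.
  by rewrite -natr1 !mulrDl !mul1r fD ?mulr_ge0 // IHk.
have fle s t : 0 <= s -> s <= t -> f s <= f t.
  move=> s0 st; rewrite -[t](subrK s) addrC fD ?subr_ge0 //.
  by rewrite lerDl f0 // subr_ge0.
move=> t t0; have f1 := f0 1 ler01.
have bound (m : nat) : m%:R * `|f t - t * f 1| <= f 1.
  pose k := Num.truncn (m%:R * t).
  have /andP[km mk] : k%:R <= m%:R * t < k.+1%:R.
    by apply: Num.Theory.truncn_itv; rewrite mulr_ge0.
  have h1 := fle _ _ (ler0n R k) km.
  have h2 : f (m%:R * t) <= f (k.+1%:R).
    by apply: fle; rewrite ?mulr_ge0 // ltW.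
  have := fM k 1 ler01; have := fM k.+1 1 ler01.
  rewrite !mulr1 (fM m t t0) in h1 h2 * => k1 k2.
  rewrite k2 in h1; rewrite k1 -natr1 in h2; rewrite -natr1 in mk.
  rewrite -[m%:R in leLHS]ger0_norm // -normrM ler_norml.
  by apply/andP; split; nra.
apply/eqP; rewrite -subr_eq0 -normr_le0 leNgt; apply/negP => d0.
have := bound (Num.truncn (f 1 / `|f t - t * f 1|)).+1.
by rewrite -ler_pdivlMr // leNgt Num.Theory.truncnS_gt.
Qed.

Lemma ge0_of_perturb (R : realType) (a b : R) :
  (forall e, 0 < e -> 0 <= a + e * b) -> 0 <= a.
Proof.
move=> ab; rewrite leNgt; apply/negP => a0.
have B : 0 < `|b| + 1 by rewrite ltr_wpDl.
(* Small enough that [e * b] stays below [- a / 2]; the added 1 guards against [b = 0]. *)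
have := ab (- a / (2 * (`|b| + 1))).
have e0 : 0 < - a / (2 * (`|b| + 1)) by rewrite divr_gt0 ?mulr_gt0 // oppr_gt0.
move=> /(_ e0).
set e := _ / _ in e0 *.
have : e * (2 * (`|b| + 1)) = - a by rewrite /e; field; rewrite gt_eqF.
have := ler_norm b; have := normr_ge0 b.
by nra.
Qed.

(** * Linear independence of two vectors *)

Section Independence.
Variables (R : realType) (n : nat).
Implicit Types (u v w y : 'cV[R]_n).

Definition indep u v : Prop :=
  forall a b : R, a *: u + b *: v = 0 -> a = 0 /\ b = 0.

Lemma indepC u v : indep u v -> indep v u.
Proof. by move=> uv a b; rewrite addrC => /uv[]. Qed.

Lemma indep_nparallel u v b : indep u v -> u <> b *: v.
Proof.
move=> uv uE; have [] := uv 1 (- b).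
  by rewrite scale1r uE scaleNr subrr.
by move=> /eqP; rewrite oner_eq0.
Qed.

Lemma indep_neq0 u v : indep u v -> u != 0.
Proof.
by move=> uv; apply/eqP => u0; apply: (indep_nparallel (b := 0) uv);
  rewrite scale0r.
Qed.

Lemma indepVparallel u v : v != 0 -> indep u v \/ exists c, u = c *: v.
Proof.
move=> v0; have [|np] := pselect (exists c, u = c *: v); first by right.
left=> a b ab; have [a0|a0] := eqVneq a 0.
  split=> //; move/eqP: ab; rewrite a0 scale0r add0r scaler_eq0 (negbTE v0).
  by rewrite orbF => /eqP.
case: np; exists (- (a^-1 * b)); apply/eqP.
rewrite scaleNr -subr_eq0 opprK -scalerA -(scalerK a0 u) -scalerDr ab.
by rewrite scaler0.
Qed.

Lemma exists_indep v : (2 <= n)%N -> v != 0 -> exists y, indep y v.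
Proof.
move=> n2 v0; have [i vi] : exists i, v i 0 != 0.
  apply: contrapT => vi; move/eqP: v0; apply; apply/matrixP => i j.
  rewrite ord1 mxE; apply/eqP; apply: contrapT => /negP vi0.
  by apply: vi; exists i.
have [j ij] : exists j : 'I_n, j != i.
  by apply/existsP; rewrite -[n]card_ord in n2;
    have := n2; rewrite (cardD1 i) ltnS => /card_gt0P[j /[!inE]/andP[ji _]];
    apply/existsP; exists j.
exists (delta_mx j 0) => a b ab.
have b0 : b = 0.
  have /eqP := congr1 (fun M : 'cV[R]_n => M i 0) ab.
  rewrite !mxE [i == j]eq_sym (negbTE ij) mulr0 add0r mulf_eq0 (negbTE vi) orbF.
  by move/eqP.
split=> //; have := congr1 (fun M : 'cV[R]_n => M j 0) ab.
by rewrite b0 !mxE !eqxx mulr1 mul0r addr0.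
Qed.

(** The component of [u] orthogonal to [v] is then orthogonal to [u] as well, hence to itself. *)
Lemma parallel_of_orth u v : (forall z, dot v z = 0 -> dot u z = 0) ->
  exists b, u = b *: v.
Proof.
move=> vu; have [v0|v0] := eqVneq v 0.
  exists 0; rewrite scale0r; apply: dot_eq0; apply: vu.
  by rewrite v0 dotC dot0r.
exists (dot u v / dot v v); apply/eqP; rewrite -subr_eq0; apply/eqP/dot_eq0.
set b := _ / _.
have vz : dot v (u - b *: v) = 0.
  by rewrite !dotlin (dotC v u) /b; field; rewrite gt_eqF ?dot_gt0.
by rewrite {1}dotDl dotNl dotZl vz mulr0 subr0 vu.
Qed.

End Independence.

(** * Order automorphisms of the positive definite cone *)

Section OrderAutomorphism.
Variables (R : realType) (n : nat).
Implicit Types (phi : 'M[R]_n -> 'M[R]_n) (X Y P Q : 'M[R]_n).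
Implicit Types (u v w x y z : 'cV[R]_n).

Local Notation pd := (@posdef R n).

Lemma aut_posdef phi X : order_automorphism pd phi -> pd X -> pd (phi X).
Proof. by move=> [_ [phiM _ _] _]; exact: phiM. Qed.

Lemma aut_inj phi X Y : order_automorphism pd phi ->
  pd X -> pd Y -> phi X = phi Y -> X = Y.
Proof. by move=> [_ [_ + _] _] X0 Y0; apply; rewrite inE. Qed.

Lemma aut_le phi X Y : order_automorphism pd phi ->
  pd X -> pd Y -> posemidef (Y - X) -> posemidef (phi Y - phi X).
Proof. by move=> [_ _ h] X0 Y0; apply: (h _ _ X0 Y0).1. Qed.

(** The inverse is again an order automorphism, so each one-sided statement below can also be
    applied backwards. Outside the cone [psi] is arbitrary. *)
Lemma aut_inverse phi : order_automorphism pd phi ->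
  exists psi, [/\ order_automorphism pd psi,
    forall X, pd X -> psi (phi X) = X & forall Y, pd Y -> phi (psi Y) = Y].
Proof.
move=> aphi; have [Msym [phiM _ phi_surj] _] := aphi.
have /choice[psi psiP] : forall Y, exists X, pd Y -> pd X /\ phi X = Y.
  move=> Y; have [Y0|] := pselect (pd Y); last by exists 0.
  by have [X X0 XY] := phi_surj Y Y0; exists X.
have psi_pd Y : pd Y -> pd (psi Y) by move=> /psiP[].
have psiK Y : pd Y -> phi (psi Y) = Y by move=> /psiP[].
have phiK X : pd X -> psi (phi X) = X.
  move=> X0; have pX := aut_posdef aphi X0.
  by apply: (aut_inj aphi) => //; [exact: psi_pd | exact: psiK].
exists psi; split=> //; split=> // [|X Y X0 Y0].
  split=> [Y /psi_pd //|X Y /set_mem X0 /set_mem Y0 XY|X X0].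
    by rewrite -(psiK X X0) XY psiK.
  by exists (phi X); [exact: aut_posdef | exact: phiK].
rewrite /loewner_le -{1}(psiK X X0) -{1}(psiK Y Y0).
by have [_ _ h] := aphi; apply: iff_sym; apply: h; exact: psi_pd.
Qed.

(** * Images of rank-one rays *)

(** The inverse carries the order interval below the increment into the interval below [outer v],
    which is a chain; [outer_chainP] then applies to the increment. *)
Lemma aut_outer phi X v : order_automorphism pd phi -> pd X ->
  exists w, phi (X + outer v) = phi X + outer w.
Proof.
move=> aphi X0; have Xv0 := posdefD X0 (psd_outer v).
have D0 : posemidef (phi (X + outer v) - phi X).
  by apply: (aut_le aphi) => //; rewrite addrC addKr; exact: psd_outer.
have [psi [apsi phiK psiK]] := aut_inverse aphi.
have pX0 := aut_posdef aphi X0; have pXv0 := aut_posdef aphi Xv0.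
suff /(outer_chainP D0)[w wE] : forall A B, posemidef A ->
    posemidef (phi (X + outer v) - phi X - A) -> posemidef B ->
    posemidef (phi (X + outer v) - phi X - B) ->
    posemidef (B - A) \/ posemidef (A - B).
  by exists w; rewrite -wE [RHS]addrC subrK.
have back A : posemidef A -> posemidef (phi (X + outer v) - phi X - A) ->
    posemidef (psi (phi X + A) - X) /\
    posemidef (outer v - (psi (phi X + A) - X)).
  move=> A0 DA; have pA := posdefD pX0 A0; split.
    rewrite -{2}(phiK X X0); apply: (aut_le apsi) => //.
    by rewrite addrC addKr.
  have -> : outer v - (psi (phi X + A) - X) =
            psi (phi (X + outer v)) - psi (phi X + A).
    by rewrite phiK // opprB addrCA addrA.
  by apply: (aut_le apsi) => //; rewrite opprD addrA.
move=> A B A0 DA B0 DB.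
have [A1 A2] := back A A0 DA; have [B1 B2] := back B B0 DB.
have pA := posdefD pX0 A0; have pB := posdefD pX0 B0.
have sub U V W : U - W - (V - W) = U - V :> 'M[R]_n.
  by rewrite opprB addrA subrK.
have [_ /(_ (ex_intro _ v erefl))/(_ _ _ A1 A2 B1 B2)] :=
  outer_chainP (psd_outer v).
rewrite !sub => -[] /(aut_le aphi); rewrite !psiK // => h; [left|right];
  by have := h; rewrite opprD addrACA subrr add0r; apply;
    apply: (aut_posdef apsi).
Qed.

(** The increment at [t] has rank at most one and is comparable with [outer w], the increment at 1,
    so the two are proportional. For [t > 1] the comparison is reversed and the factor is
    inverted. *)
Lemma aut_ray phi X v w : order_automorphism pd phi -> pd X -> w != 0 ->
  phi (X + outer v) = phi X + outer w ->
  forall t, 0 <= t -> exists2 s, 0 <= s &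
    phi (X + t *: outer v) = phi X + s *: outer w.
Proof.
move=> aphi X0 w0 phiXv t t0.
have [wt phiXt] : exists wt, phi (X + t *: outer v) = phi X + outer wt.
  by rewrite outer_sqrt //; exact: aut_outer.
have X1 := posdefD X0 (psd_outer v).
have Xt := posdefD X0 (psdZ t0 (psd_outer v)).
have subX A B : X + A - (X + B) = A - B by rewrite opprD addrACA subrr add0r.
have [t1|t1] := leP t 1.
  have : posemidef (outer w - outer wt).
    have := aut_le aphi Xt X1; rewrite phiXt phiXv.
    rewrite subX opprD [phi X + _ + _]addrACA subrr add0r; apply.
    rewrite -{1}[outer v]scale1r -scalerBl.
    by apply: psdZ (psd_outer _); rewrite subr_ge0.
  move=> /(psd_below_outer (psd_outer wt))[s s0 wtE].
  by exists s => //; rewrite phiXt wtE.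
have : posemidef (outer wt - outer w).
  have := aut_le aphi X1 Xt; rewrite phiXt phiXv.
  rewrite subX opprD [phi X + _ + _]addrACA subrr add0r; apply.
  rewrite -{2}[outer v]scale1r -scalerBl.
  by apply: psdZ (psd_outer _); rewrite subr_ge0 ltW.
move=> /(psd_below_outer (psd_outer w))[s s0 wE].
exists s^-1; first by rewrite invr_ge0.
rewrite phiXt wE scalerA mulVf ?scale1r //; apply: contra w0 => /eqP s_eq0.
by apply/eqP/outer_eq0; rewrite wE s_eq0 scale0r.
Qed.

(** Equality of the image of one ray with another ray as sets; nothing is claimed yet on how [s]
    depends on [t]. *)
Definition ray_image phi X v w : Prop :=
  (forall t, 0 <= t -> exists2 s, 0 <= s &
     phi (X + t *: outer v) = phi X + s *: outer w) /\
  (forall s, 0 <= s -> exists2 t, 0 <= t &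
     phi (X + t *: outer v) = phi X + s *: outer w).

Lemma aut_ray_image phi X v : order_automorphism pd phi -> pd X -> v != 0 ->
  exists2 w, w != 0 & ray_image phi X v w.
Proof.
move=> aphi X0 v0; have [w phiXv] := aut_outer v aphi X0.
have Xv := posdefD X0 (psd_outer v).
have w0 : w != 0.
  apply: contra v0 => /eqP w0; apply/eqP/outer_eq0.
  move: phiXv; rewrite w0 outer0 addr0 => /(aut_inj aphi Xv X0) XvE.
  by apply: (addrI X); rewrite addr0.
exists w => //; split=> [t t0|s s0]; first exact: (aut_ray aphi).
have [psi [apsi phiK psiK]] := aut_inverse aphi.
have pX := aut_posdef aphi X0.
have : psi (phi X + outer w) = psi (phi X) + outer v.
  by rewrite -phiXv !phiK.
move=> /(aut_ray apsi pX v0)/(_ s s0)[t t0 psiE].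
exists t => //; rewrite -{1}(phiK X X0) -psiE psiK //.
by apply: posdefD => //; apply: psdZ (psd_outer _).
Qed.

(* The image of the ray from [X] is unbounded and stays below the image of the
   ray from [Y]; this forces the two directions to agree. *)
Lemma ray_image_le phi X Y v w1 w2 : order_automorphism pd phi ->
  pd X -> pd Y -> posemidef (Y - X) ->
  ray_image phi X v w1 -> ray_image phi Y v w2 -> exists b, w1 = b *: w2.
Proof.
move=> aphi X0 Y0 XY [_ rX] [rY _]; apply: parallel_of_orth => z w2z.
pose p := dot z (phi X *m z); pose q := dot z (phi Y *m z).
have bound s : 0 <= s -> p + s * dot w1 z ^+ 2 <= q.
  move=> s0; have [t t0 phiXt] := rX s s0; have [s' s'0 phiYt] := rY t t0.
  have tv := psdZ t0 (psd_outer v).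
  have := aut_le aphi (posdefD X0 tv) (posdefD Y0 tv).
  rewrite opprD addrACA subrr addr0 => /(_ XY)/(le_form z).
  rewrite phiXt phiYt !mulmxDl -!scalemxAl !outer_mul !dotlin w2z mul0r mulr0.
  by rewrite addr0 (dotC z w1) -expr2.
have pq : p <= q by have := bound 0 (lexx _); rewrite mul0r addr0.
apply/eqP; apply: contraT => w1z.
have d0 : 0 < dot w1 z ^+ 2 by rewrite exprn_even_gt0.
(* At this parameter the left side of [bound] equals [q + 1]. *)
have : 0 <= (q - p + 1) / dot w1 z ^+ 2.
  by rewrite divr_ge0 ?ltW // ltr_wpDl // subr_ge0.
by move=> /bound; rewrite divfK ?gt_eqF //; lra.
Qed.

(** The direction found at the identity serves every [X]: both points lie below [X + 1%:M], and
    [ray_image_le] compares each of their directions with the one there. *)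
Lemma aut_direction phi v : order_automorphism pd phi -> v != 0 ->
  exists w, forall X t, pd X -> 0 <= t ->
    exists2 s, 0 <= s & phi (X + t *: outer v) = phi X + s *: outer w.
Proof.
move=> aphi v0; have I0 : pd 1%:M := posdef1 R n.
have [w w0 rI] := aut_ray_image aphi I0 v0.
exists w => X t X0 t0; have [w1 w10 rX] := aut_ray_image aphi X0 v0.
have Z0 := posdefD X0 (posdef_psd I0).
have [w2 w20 rZ] := aut_ray_image aphi Z0 v0.
have [|b w1E] := ray_image_le aphi X0 Z0 _ rX rZ.
  by rewrite addrC addKr; apply: psd1.
have [|c wE] := ray_image_le aphi I0 Z0 _ rI rZ.
  by rewrite addrK; apply: posdef_psd.
have [s s0 ->] := rX.1 t t0.
have c0 : c != 0 by apply: contra w0 => /eqP c0; rewrite wE c0 scale0r.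
exists (s * (b / c) ^+ 2); first by rewrite mulr_ge0 ?sqr_ge0.
by rewrite -scalerA -outerZ wE scalerA divfK // -w1E.
Qed.

(** If the image directions were parallel, the images of [1%:M + outer u] and [1%:M + outer v] would
    lie on one ray and be comparable. Pulled back, this makes [outer u] and [outer v] comparable,
    hence [u] and [v] parallel. *)
Lemma aut_indep phi u v wu wv : order_automorphism pd phi -> indep u v ->
  (forall X t, pd X -> 0 <= t ->
    exists2 s, 0 <= s & phi (X + t *: outer u) = phi X + s *: outer wu) ->
  (forall X t, pd X -> 0 <= t ->
    exists2 s, 0 <= s & phi (X + t *: outer v) = phi X + s *: outer wv) ->
  forall b, wv <> b *: wu.
Proof.
move=> aphi uv ru rv b wvE; have I0 : pd 1%:M := posdef1 R n.
have [psi [apsi phiK psiK]] := aut_inverse aphi.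
have [s s0 uE] := ru _ 1 I0 ler01; have [s' s'0 vE] := rv _ 1 I0 ler01.
rewrite !scale1r in uE vE.
have u1 := posdefD I0 (psd_outer u); have v1 := posdefD I0 (psd_outer v).
have sub U V W : W + U - (W + V) = U - V :> 'M[R]_n.
  by rewrite opprD addrACA subrr add0r.
rewrite wvE outerZ scalerA in vE.
have [le|le] := leP s (s' * b ^+ 2).
  have : posemidef (outer v - outer u).
    rewrite -(sub _ _ 1%:M) -(phiK _ u1) -(phiK _ v1).
    apply: (aut_le apsi); [exact: aut_posdef..|].
    rewrite uE vE sub -scalerBl; apply: psdZ (psd_outer _).
    by rewrite subr_ge0.
  move=> /(psd_below_outer (psd_outer u))[c _ /outer_parallel[d]].
  exact: indep_nparallel.
have : posemidef (outer u - outer v).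
  rewrite -(sub _ _ 1%:M) -(phiK _ u1) -(phiK _ v1).
  apply: (aut_le apsi); [exact: aut_posdef..|].
  rewrite uE vE sub -scalerBl; apply: psdZ (psd_outer _).
  by rewrite subr_ge0 ltW.
move=> /(psd_below_outer (psd_outer v))[c _ /outer_parallel[d]].
exact/indep_nparallel/indepC.
Qed.

(** * Increments do not depend on the base point *)

Lemma aut_incr_indep phi X u v : order_automorphism pd phi -> pd X ->
  indep u v ->
  phi (X + outer u + outer v) - phi (X + outer u) = phi (X + outer v) - phi X.
Proof.
move=> aphi X0 uv.
have [wu ru] := aut_direction aphi (indep_neq0 uv).
have [wv rv] := aut_direction aphi (indep_neq0 (indepC uv)).
have npar := aut_indep aphi uv ru rv.
have Xu := posdefD X0 (psd_outer u); have Xv := posdefD X0 (psd_outer v).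
have [s _ sE] := ru _ 1 X0 ler01; have [t _ tE] := rv _ 1 X0 ler01.
have [s' _ s'E] := ru _ 1 Xv ler01; have [t' _ t'E] := rv _ 1 Xu ler01.
rewrite !scale1r in sE tE s'E t'E.
rewrite t'E tE addrAC subrr add0r addrAC subrr add0r.
have [->//|tt'] := eqVneq t t'.
(* The two paths around the parallelogram from [X] to [X + outer u + outer v] end at the same
   image. *)
have D : (t' - t) *: outer wv = (s' - s) *: outer wu.
  have : phi X + s *: outer wu + t' *: outer wv =
         phi X + t *: outer wv + s' *: outer wu.
    by rewrite -sE -tE -t'E -s'E addrAC.
  rewrite -!addrA => /addrI E; rewrite !scalerBl.
  have -> : t' *: outer wv = t *: outer wv + s' *: outer wu - s *: outer wu.
    by rewrite -E addrAC subrr add0r.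
  by rewrite addrAC [t *: _ + _]addrC addrK.
have tt0 : t' - t != 0 by rewrite subr_eq0 eq_sym.
have /outer_parallel[b] : outer wv = ((t' - t)^-1 * (s' - s)) *: outer wu.
  by rewrite -scalerA -D scalerK.
by move/npar.
Qed.

(** For [u] parallel to [v], the increment along [v] is first transported from [X + outer u] to
    [X + outer u + outer y] with [y] independent of [v], then back to [X] along two other directions
    independent of [v]. *)
Lemma aut_incr_outer phi X u v : (2 <= n)%N -> order_automorphism pd phi ->
  pd X ->
  phi (X + outer u + outer v) - phi (X + outer u) = phi (X + outer v) - phi X.
Proof.
move=> n2 aphi X0; have [->|v0] := eqVneq v 0.
  by rewrite outer0 !addr0 !subrr.
have [|[c ucv]] := indepVparallel u v0; first exact: aut_incr_indep.
have [y yv] := exists_indep n2 v0.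
(* The rotation by the Pythagorean angle (3/5, 4/5) rewrites
   [outer u + outer y] as a sum over two vectors independent of [v]. *)
pose y1 := (3 / 5) *: u + (4 / 5) *: y.
pose y2 := (4 / 5) *: u + (- (3 / 5)) *: y.
have rot (e : R) : e != 0 -> forall d, indep (d *: u + e *: y) v.
  move=> e0 d a b; rewrite ucv !scalerDr !scalerA addrAC -scalerDl addrC.
  move=> /yv[/eqP]; rewrite mulf_eq0 (negbTE e0) orbF => /eqP -> /eqP.
  by rewrite !mul0r add0r => /eqP ->.
have uy : outer u + outer y = outer y1 + outer y2.
  by apply/matrixP => i j; rewrite [LHS]mxE [RHS]mxE !outerE !mxE; field.
have Xu := posdefD X0 (psd_outer u).
have Xy1 := posdefD X0 (psd_outer y1).
rewrite -(aut_incr_indep aphi Xu yv) -(addrA X) uy addrA.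
rewrite (aut_incr_indep aphi Xy1); last first.
  by apply: rot; rewrite oppr_eq0; apply: lt0r_neq0; lra.
by apply: aut_incr_indep => //; apply: rot; apply: lt0r_neq0; lra.
Qed.

(** Both [P] and [Q] are split into rank-one terms: [step] moves the base point through the terms of
    [P], and the increments over the terms of [Q] telescope. *)
Lemma aut_incr_psd phi X P Q : (2 <= n)%N -> order_automorphism pd phi ->
  pd X -> posemidef P -> posemidef Q ->
  phi (X + P + Q) - phi (X + P) = phi (X + Q) - phi X.
Proof.
move=> n2 aphi X0 P0 Q0.
have step Y v : pd Y ->
    phi (Y + P + outer v) - phi (Y + P) = phi (Y + outer v) - phi Y.
  have [s ->] := psd_sum_outer P0; elim: s Y => [|u s IHs] Y Y0.
    by rewrite big_nil !addr0.
  rewrite big_cons !addrA IHs; last exact: posdefD (psd_outer _).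
  exact: aut_incr_outer.
have [s ->] := psd_sum_outer Q0; elim: s X X0 => [|v s IHs] X X0.
  by rewrite big_nil !addr0 !subrr.
have Xv := posdefD X0 (psd_outer v).
rewrite big_cons !addrA (addrAC X P) -(subrKA (phi (X + outer v + P))).
by rewrite IHs // (addrAC X _ P) step // subrKA.
Qed.

Lemma aut_linear phi : (2 <= n)%N -> order_automorphism pd phi ->
  exists L : 'M[R]_n -> 'M[R]_n,
  [/\ forall P, posemidef P -> posemidef (L P),
      forall P Q, posemidef P -> posemidef Q -> L (P + Q) = L P + L Q,
      forall t P, 0 <= t -> posemidef P -> L (t *: P) = t *: L P,
      forall v, exists w, L (outer v) = outer w &
      forall X, pd X -> phi X = L X].
Proof.
move=> n2 aphi; have I0 : pd 1%:M := posdef1 R n.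
pose L P := phi (1%:M + P) - phi 1%:M.
have phiD X P : pd X -> posemidef P -> phi (X + P) = phi X + L P.
  move=> X0 P0; apply/eqP; rewrite [eqbRHS]addrC -subr_eq; apply/eqP.
  (* The increments at [X] and at [1%:M] both equal the one at [X + 1%:M]. *)
  rewrite -(aut_incr_psd n2 aphi X0 (psd1 R n) P0) (addrC X) /L.
  exact: (aut_incr_psd n2 aphi I0 (posdef_psd X0) P0).
have L0 P : posemidef P -> posemidef (L P).
  move=> P0; apply: (aut_le aphi) => //; first exact: posdefD.
  by rewrite addrC addKr.
have LD P Q : posemidef P -> posemidef Q -> L (P + Q) = L P + L Q.
  move=> P0 Q0; rewrite {1}/L addrA phiD //; last exact: posdefD.
  by rewrite addrAC.
have LZ t P : 0 <= t -> posemidef P -> L (t *: P) = t *: L P.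
  move=> t0 P0; apply: form_inj => [||x].
  - exact/psd_sym/L0/psdZ.
  - by rewrite linearZ /= psd_sym //; apply: L0.
  (* For fixed [x] this is additive and nonnegative in [s >= 0], hence linear there. *)
  pose f s := dot x (L (s *: P) *m x).
  have := @additive_nonneg_linear R f _ _ t t0.
  rewrite /f scale1r => ->; rewrite -?scalemxAl ?dotZr //.
    by move=> a b a0 b0; rewrite scalerDl LD ?mulmxDl ?dotDr //; apply: psdZ.
  by move=> a a0; apply/psd_ge0/L0/psdZ.
exists L; split=> // [v|X X0].
  have [w wE] := aut_outer v aphi I0; exists w.
  by rewrite /L wE addrAC subrr add0r.
pose K := phi 1%:M - L 1%:M.
have phiK Y : pd Y -> phi Y = K + L Y.
  move=> Y0; apply: (addIr (L 1%:M)); rewrite addrAC subrK.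
  by rewrite -!phiD ?(addrC Y) //; exact: posdef_psd.
suff K0 : K = 0 by rewrite phiK // K0 add0r.
have sK : K^T = K.
  rewrite /K linearB /= !psd_sym //; first exact/L0/psd1.
  exact/posdef_psd/aut_posdef.
have [_ [_ _ phi_surj] _] := aphi.
(* [K >= 0] follows from [phi (e *: 1%:M) = K + e *: L 1%:M] as [e] tends to 0; [- K >= 0] follows
   by writing [e *: 1%:M] as [phi Y = K + L Y] with [L Y >= 0]. *)
apply: psd_anti; apply/psdP; split; rewrite ?linearN /= ?sK // => x.
  apply: (@ge0_of_perturb _ _ (dot x (L 1%:M *m x))) => e e0.
  have eI := posdefZ e0 I0.
  rewrite -dotZr scalemxAl -dotDr -mulmxDl -(LZ _ _ (ltW e0) (psd1 R n)).
  by rewrite -phiK //; apply/psd_ge0/posdef_psd/aut_posdef.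
apply: (@ge0_of_perturb _ _ (dot x x)) => e e0.
have [Y Y0 YE] := phi_surj _ (posdefZ e0 I0).
have := psd_ge0 x (L0 _ (posdef_psd Y0)).
have -> : L Y = - K + e *: 1%:M by rewrite -YE phiK // addKr.
by rewrite mulmxDl dotDr -scalemxAl mul1mx dotZr.
Qed.

End OrderAutomorphism.

(** * Additive cone maps preserving rank one *)

Section LinearMapsOfTheCone.
Variables (R : realType) (n : nat).
Implicit Types (P Q C T : 'M[R]_n) (u v w : 'cV[R]_n).

Local Notation e_ i := (delta_mx i 0 : 'cV[R]_n).

(** Polarisation: [b] is shown to be a symmetric bilinear form with [q] as its quadratic form. *)
Lemma cone_functional_form (l : 'M[R]_n -> R) :
  (forall P Q, posemidef P -> posemidef Q -> l (P + Q) = l P + l Q) ->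
  (forall t P, 0 <= t -> posemidef P -> l (t *: P) = t * l P) ->
  exists2 C, C^T = C & forall v, l (outer v) = dot v (C *m v).
Proof.
move=> lD lZ; pose q v := l (outer v).
pose b u v := (q (u + v) - q u - q v) / 2.
have qZ t v : q (t *: v) = t ^+ 2 * q v.
  by rewrite /q outerZ lZ ?sqr_ge0 //; exact: psd_outer.
have bC u v : b u v = b v u by rewrite /b (addrC u); ring.
have bvv v : b v v = q v.
  have -> : b v v = (q ((1 + 1) *: v) - q v - q v) / 2.
    by rewrite scalerDl scale1r.
  by rewrite qZ; field.
have l3 P Q C : posemidef P -> posemidef Q -> posemidef C ->
    l (P + Q + C) = l P + l Q + l C.
  by move=> P0 Q0 C0; rewrite lD ?lD //; exact: psdD.
have o := @psd_outer R n.
have bD u v w : b u (v + w) = b u v + b u w.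
  (* Stated without subtraction, since [l] is additive on semidefinite matrices only; both sides are
     [l] of the same matrix. *)
  suff : q (u + (v + w)) + (q u + q v + q w) =
         q (u + v) + q (u + w) + q (v + w).
    by rewrite /b => E; lra.
  rewrite /q -l3 // -lD //; last by apply: psdD => //; apply: psdD.
  rewrite -l3 //; congr l; apply/matrixP => i j.
  by rewrite !mxE !big_ord1 !mxE; ring.
have bZ_ge0 u v t : 0 <= t -> b u (t *: v) = t * b u v.
  move=> t0; have oZ w s : 0 <= s -> posemidef (s *: outer w).
    by move=> s0; exact: psdZ.
  suff : q (u + t *: v) + t * q u + t * q v =
         q u + t * q (u + v) + t ^+ 2 * q v.
    by move=> E; rewrite /b qZ; lra.
  rewrite /q -!lZ ?sqr_ge0 // -l3; [|exact: o|exact: oZ|exact: oZ].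
  rewrite -l3; [|exact: o|exact: oZ|by apply: oZ; rewrite sqr_ge0].
  congr l; apply/matrixP => i j.
  by rewrite !mxE !big_ord1 !mxE; ring.
have b0 u : b u 0 = 0 by rewrite -(scale0r 0) bZ_ge0 // mul0r.
have bZ u v t : b u (t *: v) = t * b u v.
  have [t0|t0] := leP 0 t; first exact: bZ_ge0.
  apply: (addIr (b u ((- t) *: v))); rewrite -bD -scalerDl subrr scale0r b0.
  by rewrite bZ_ge0 ?oppr_ge0 ?ltW //=; ring.
exists (\matrix_(i, j) b (e_ i) (e_ j)).
  by apply/matrixP => i j; rewrite !mxE bC.
have expand u v : b u v = \sum_j v j 0 * b u (e_ j).
  have {1}-> : v = \sum_j v j 0 *: e_ j.
    apply/matrixP => i j; rewrite ord1 summxE (bigD1 i) //= big1 => [|k ki].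
      by rewrite !mxE !eqxx mulr1 addr0.
    by rewrite !mxE eq_sym (negbTE ki) mulr0.
  elim/big_rec2: _ => [|j x y _ <-]; first exact: b0.
  by rewrite bD bZ.
move=> v; rewrite -/(q v) -bvv expand dotE; apply: eq_bigr => i _.
rewrite mxE bC expand; congr (_ * _); apply: eq_bigr => j _.
by rewrite mxE mulrC.
Qed.

Lemma additive_sum_outer (L : 'M[R]_n -> 'M[R]_n) (s : seq 'cV[R]_n) :
  (forall P Q, posemidef P -> posemidef Q -> L (P + Q) = L P + L Q) ->
  L (\sum_(v <- s) outer v) = \sum_(v <- s) L (outer v).
Proof.
move=> LD; elim: s => [|v s IHs].
  rewrite !big_nil; apply: (addrI (L 0)); rewrite addr0 -LD ?addr0 //;
    exact: psd0.
rewrite !big_cons LD ?IHs //; first exact: psd_outer.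
by apply: psd_sum => u; exact: psd_outer.
Qed.

(** Each entry of [L (outer v)] is a quadratic form in [v]. Positivity determines the diagonal
    entries, and rank one then determines the others up to sign. *)
Lemma cone_linear_signs (L : 'M[R]_n -> 'M[R]_n) :
  (forall P, posemidef P -> posemidef (L P)) ->
  (forall P Q, posemidef P -> posemidef Q -> L (P + Q) = L P + L Q) ->
  (forall t P, 0 <= t -> posemidef P -> L (t *: P) = t *: L P) ->
  (forall v, exists w, L (outer v) = outer w) ->
  (forall i, L (outer (e_ i)) = outer (e_ i)) ->
  exists2 w : 'cV[R]_n, forall i, w i 0 ^+ 2 = 1 &
    forall P, posemidef P -> forall i j, L P i j = w i 0 * w j 0 * P i j.
Proof.
move=> L0 LD LZ L1 Le.
have form k l : exists2 C, C^T = C &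
    forall v, L (outer v) k l = dot v (C *m v).
  apply: (@cone_functional_form (fun P => L P k l)) => [P Q P0 Q0|t P t0 P0].
    by rewrite LD // mxE.
  by rewrite LZ // mxE.
have diag k v : L (outer v) k k = v k 0 ^+ 2.
  have [C sC CE] := form k k.
  have C0 : posemidef C.
    apply/psdP; split=> // x; rewrite -CE -dot_entry.
    exact/psd_ge0/L0/psd_outer.
  have Ci i : C i i = (k == i)%:R.
    by rewrite -dot_entry -CE Le outerE !mxE eqxx andbT -natrM mulnb andbb.
  have Cz i j : k != i -> C j i = 0.
    (* A zero diagonal entry of a semidefinite matrix annihilates its column. *)
    move=> ki; rewrite -dot_entry psd_ker ?dot0r // dot_entry Ci.
    by rewrite (negbTE ki).
  suff CE' : C = outer (e_ k).
    by rewrite CE CE' outer_mul dotZr (dotC v) dot_delta.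
  apply/matrixP => i j; rewrite outerE !mxE eqxx !andbT.
  have [->|ik] := eqVneq i k; last by rewrite mul0r -sC mxE Cz // eq_sym.
  have [->|jk] := eqVneq j k; last by rewrite mulr0 Cz // eq_sym.
  by rewrite mulr1 Ci eqxx.
have offdiag k l : k != l -> exists c, forall v,
    L (outer v) k l = c * (v k 0 * v l 0).
  move=> kl; have [C sC CE] := form k l.
  (* The 2 by 2 minor of the rank-one matrix [L (outer v)] on the indices [k] and [l] vanishes. *)
  have sqE v : dot v (C *m v) ^+ 2 = v k 0 ^+ 2 * v l 0 ^+ 2.
    by rewrite -!diag -CE; have [a ->] := L1 v; rewrite !outerE; ring.
  have deltaE i (m : 'I_n) : e_ i m 0 = (m == i)%:R by rewrite mxE eqxx andbT.
  have C_ii i : C i i = 0.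
    apply/eqP; rewrite -sqrf_eq0 -dot_entry sqE !deltaE -exprMn.
    have [ki|_] := eqVneq k i; last by rewrite mul0r expr0n.
    by rewrite -ki [l == k]eq_sym (negbTE kl) mulr0 expr0n.
  have C_ij i j : ~~ ((i == k) && (j == l)) -> ~~ ((i == l) && (j == k)) ->
      C i j = 0.
    move=> h1 h2; have [->|ij] := eqVneq i j; first exact: C_ii.
    (* The form takes the value [2 * C i j] here, and the product on the right vanishes unless [i]
       and [j] are [k] and [l] in some order. *)
    have := sqE (e_ i + e_ j).
    rewrite mulmxDr !dotlin !dot_entry !C_ii !mxE !eqxx !andbT add0r addr0.
    have -> : C j i = C i j by rewrite -[in LHS]sC mxE.
    have -> : (((k == i)%:R + (k == j)%:R) ^+ 2 *
               ((l == i)%:R + (l == j)%:R) ^+ 2 = 0 :> R).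
      move: h1 h2; rewrite (eq_sym i k) (eq_sym j k) (eq_sym i l) (eq_sym j l).
      have [ki|_] := eqVneq k i; have [kj|_] := eqVneq k j;
        have [li|_] := eqVneq l i; have [lj|_] := eqVneq l j => //= _ _;
        rewrite ?addr0 ?expr0n ?mulr0 ?mul0r //.
      - by rewrite ki li eqxx in kl.
      - by rewrite kj lj eqxx in kl.
    move/eqP; rewrite sqrf_eq0 -mulr2n mulrn_eq0 /= => /eqP //.
  have CE' : C = C k l *: (outer (e_ k + e_ l) - outer (e_ k) - outer (e_ l)).
    apply/matrixP => i j; rewrite !mxE !big_ord1 !mxE !eqxx !andbT.
    have [->|ik] := eqVneq i k; have [->|jk] := eqVneq j k;
      rewrite ?C_ii ?(negbTE kl) /=.
    - by ring.
    - have [->|jl] := eqVneq j l; first by rewrite /=; ring.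
      by rewrite C_ij ?eqxx ?(negbTE jl) ?(negbTE kl) //=; ring.
    - have [->|il] := eqVneq i l; first by rewrite -[in LHS]sC mxE /=; ring.
      by rewrite C_ij ?(negbTE ik) ?(negbTE il) //=; ring.
    - by rewrite C_ij ?(negbTE ik) ?(negbTE jk) ?andbF //=; ring.
  exists (2 * C k l) => v; rewrite CE {1}CE' -scalemxAl !mulmxBl !outer_mul.
  rewrite !(dotC v, dotlin) !dot_delta.
  by ring.
(* On the all-ones vector the entries of [L] are exactly the unknown constants, so these factor as
   [w i 0 * w j 0] with consistent signs. *)
have [w wE] := L1 (const_mx 1).
have w1 i : w i 0 ^+ 2 = 1.
  by rewrite expr2 -outerE -wE diag mxE expr1n.
exists w => // P P0 i j; have [s ->] := psd_sum_outer P0.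
rewrite additive_sum_outer // !summxE mulr_sumr; apply: eq_bigr => v _.
have [<-|ij] := eqVneq i j; first by rewrite diag -expr2 w1 mul1r outerE expr2.
have [c cE] := offdiag i j ij.
have wij : w i 0 * w j 0 = c by rewrite -outerE -wE cE !mxE !mulr1.
by rewrite cE wij outerE.
Qed.

(** The columns of [T0] are the images of the basis directions, so [L 1%:M = T0 *m T0^T] and [T0] is
    invertible. Undoing [T0] leaves a map fixing each [outer (e_ i)], which is congruence by a
    diagonal sign matrix [D]. *)
Lemma cone_linear_congruence (L : 'M[R]_n -> 'M[R]_n) :
  (forall P, posemidef P -> posemidef (L P)) ->
  (forall P Q, posemidef P -> posemidef Q -> L (P + Q) = L P + L Q) ->
  (forall t P, 0 <= t -> posemidef P -> L (t *: P) = t *: L P) ->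
  (forall v, exists w, L (outer v) = outer w) ->
  L 1%:M \in unitmx ->
  exists2 T, T \in unitmx &
    forall P, posemidef P -> L P = T *m P *m T^T.
Proof.
move=> L0 LD LZ L1 LI.
have /choice[t tE] : forall i, exists w, L (outer (e_ i)) = outer w.
  by move=> i; exact: L1.
pose T0 : 'M[R]_n := \matrix_(i, j) t j i 0.
have T0e j : T0 *m e_ j = t j.
  by apply/matrixP => i k; rewrite ord1 -colE !mxE.
have T0T : L 1%:M = T0 *m T0^T.
  have -> : (1%:M : 'M[R]_n) = \sum_(v <- [seq e_ i | i <- enum 'I_n]) outer v.
    apply/matrixP => i j; rewrite big_map big_enum /= summxE (bigD1 i) //=.
    rewrite big1 => [|k ki].
      by rewrite outerE !mxE !eqxx mul1r addr0 andbT eq_sym.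
    by rewrite outerE !mxE eq_sym (negbTE ki) mul0r.
  rewrite additive_sum_outer // big_map big_enum /=; apply/matrixP => i j.
  rewrite summxE mxE; apply: eq_bigr => k _.
  by rewrite tE outerE !mxE.
have uT0 : T0 \in unitmx by move: LI; rewrite T0T unitmx_mul => /andP[].
pose S := invmx T0.
have [w w1 wE] : exists2 w : 'cV[R]_n, forall i, w i 0 ^+ 2 = 1 &
    forall P, posemidef P ->
      forall i j, (S *m L P *m S^T) i j = w i 0 * w j 0 * P i j.
  apply: (@cone_linear_signs (fun P => S *m L P *m S^T)) => [P|P Q|a P|v|i].
  - by move=> P0; exact/psd_congr/L0.
  - by move=> P0 Q0; rewrite LD // mulmxDr mulmxDl.
  - by move=> a0 P0; rewrite LZ // -scalemxAr -scalemxAl.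
  - by have [w ->] := L1 v; exists (S *m w); rewrite mulmx_outer.
  - by rewrite tE mulmx_outer -T0e mulKmx.
pose D := diag_mx w^T.
have DE P : D *m P *m D^T = \matrix_(i, j) (w i 0 * w j 0 * P i j).
  rewrite tr_diag_mx; apply/matrixP => i j.
  by rewrite mul_mx_diag mul_diag_mx !mxE; ring.
exists (T0 *m D) => [|P P0].
  rewrite unitmx_mul uT0 unitmxE det_diag; apply: rpred_prod => i _.
  by rewrite mxE unitfE -sqrf_eq0 w1 oner_eq0.
have : S *m L P *m S^T = D *m P *m D^T.
  by rewrite DE; apply/matrixP => i j; rewrite wE // mxE.
move=> /(congr1 (fun A => T0 *m A *m T0^T)).
rewrite trmx_mul !mulmxA mulmxV // mul1mx -!mulmxA -trmx_mul mulmxV //.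
by rewrite trmx1 mulmx1.
Qed.

End LinearMapsOfTheCone.

(** * Order automorphisms of the open cone are congruences *)

Theorem theorem5p3 (R : realType) (n : nat) (phi : 'M[R]_n -> 'M[R]_n) :
  (2 <= n)%N ->
  order_automorphism (@posdef R n) phi ->
  exists2 T : 'M[R]_n, T \in unitmx &
    forall X : 'M[R]_n, posdef X -> phi X = T *m X *m T^T.
Proof.
move=> n2 aphi; have [L [L0 LD LZ L1 phiL]] := aut_linear n2 aphi.
have I0 : posdef (1%:M : 'M[R]_n) := posdef1 R n.
have LI : L 1%:M \in unitmx.
  by rewrite -phiL //; have [] := aut_posdef aphi I0.
have [T uT TE] := cone_linear_congruence L0 LD LZ L1 LI.
exists T => // X X0; rewrite phiL // TE //; exact: posdef_psd.
Qed.
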